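(* Let $R$ be a skew-invertible Hecke symmetry, $\mathbf{Y}(R)$ the corresponding braided Yangian with generating matrix $L(u)$, and let $M$ be the generating matrix of the Reflection Equation algebra $\mathcal{L}(R)$. Then the map $$L(u)\mapsto I+\frac{M}{u}$$ (i.e. $L[1]\mapsto M$, $L[k]\mapsto0$ for $k\ge2$) defines an algebra morphism $\mathbf{Y}(R)\to\mathcal{L}(R)$.
   Context: $V$ is an $N$-dimensional vector space over $\mathbb{K}=\mathbb{R}$ or $\mathbb{C}$ with a fixed basis $\{x_i\}$; an operator $R$ on $V^{\otimes 2}$ has matrix given by $R(x_i\otimes x_j)=R_{ij}^{ks}x_k\otimes x_s$ (summation over repeated indices). Lower indices on matrices indicate tensor factors: $R_{12}=R\otimes I$, $R_{23}=I\otimes R$, $L_1=L\otimes I$. Hecke symmetry: $R_{12}R_{23}R_{12}=R_{23}R_{12}R_{23}$ and $(qI-R)(q^{-1}I+R)=0$, with $q\in\mathbb{K}$ nonzero and generic ($q^n\neq1$ for all nonzero integers $n$). Skew-invertible: there is $\Psi$ on $V^{\otimes 2}$ with $R_{ij}^{kl}\Psi_{lp}^{jq'}=\delta_i^{q'}\delta_p^k$. Braided Yangian: let $R(u,v)=R-\frac{u(q-q^{-1})}{u-v}I$. $\mathbf{Y}(R)$ is the unital associative algebra generated by the entries $l_i^j[k]$ ($1\le i,j\le N$, $k\ge1$) of matrices $L[k]$, where $L(u)=\sum_{k\ge0}L[k]u^{-k}$, $L[0]=I$, subject to the relations obtained by expanding $$R(u,v)L_1(u)RL_1(v)=L_1(v)RL_1(u)R(u,v).$$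 Reflection Equation algebra: $\mathcal{L}(R)$ is the unital associative algebra generated by the entries $m_i^j$ of an $N\times N$ matrix $M$ subject to $RM_1RM_1-M_1RM_1R=0$. *)

(* Defs.v *)
From HB Require Import structures.
From mathcomp Require Import all_boot all_order all_algebra.
From mathcomp Require Import finmap boolp reals.
From mathcomp.real_closed Require Import complex mxtens.
From mathcomp.multinomials Require Import monalg.

Set Implicit Arguments.
Unset Strict Implicit.
Unset Printing Implicit Defensive.

Import GRing.Theory.
Local Open Scope ring_scope.
Local Open Scope quotient_scope.

Variant ground_field := RealField | ComplexField.

Definition scalars (F : realType) (g : ground_field) : fieldType :=
  match g with
  | RealField => F
  | ComplexField => F[i]
  end.

(* The library only quotients commutative rings by ideals; here A is an        *)
(* arbitrary algebra and in_ideal S is the two-sided ideal generated by S.     *)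
Section Ideal.
Variables (K : fieldType) (A : algType K) (S : A -> Prop).

Inductive in_ideal : A -> Prop :=
  | in_ideal0 : in_ideal 0
  | in_idealD a r b x : S r -> in_ideal x -> in_ideal (a * r * b + x).

Definition ideal : {pred A} := fun x => `[< in_ideal x >].

Lemma idealP x : reflect (in_ideal x) (x \in ideal).
Proof. exact: asboolP. Qed.

Lemma ideal_add x y : x \in ideal -> y \in ideal -> x + y \in ideal.
Proof.
move=> /idealP xI /idealP yI; apply/idealP.
elim: xI => [|a r b z Sr _ IH]; first by rewrite add0r.
by rewrite -addrA; constructor.
Qed.

Lemma ideal_mul c x d : x \in ideal -> c * x * d \in ideal.
Proof.
move=> /idealP xI; apply/idealP; elim: xI => [|a r b z Sr _ IH].
  by rewrite mulr0 mul0r; constructor.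
have -> : c * (a * r * b + z) * d = (c * a) * r * (b * d) + c * z * d.
  by rewrite mulrDr mulrDl !mulrA.
by constructor.
Qed.

Lemma ideal_mull c x : x \in ideal -> c * x \in ideal.
Proof. by move=> /(ideal_mul c 1); rewrite mulr1. Qed.

Lemma ideal_mulr d x : x \in ideal -> x * d \in ideal.
Proof. by move=> /(ideal_mul 1 d); rewrite mul1r. Qed.

Lemma ideal_zmod_closed : zmod_closed ideal.
Proof.
split=> [|x y xI yI]; first by apply/idealP; constructor.
by apply: ideal_add => //; rewrite -mulN1r; apply: ideal_mull.
Qed.

HB.instance Definition _ := GRing.isZmodClosed.Build A ideal ideal_zmod_closed.

End Ideal.

(* algType is a structure of nontrivial rings, hence the properness argument.  *)
Definition alg_quot (K : fieldType) (A : algType K) (S : A -> Prop)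
  (S_proper : 1 \notin ideal S) : Type := Quotient.quot (ideal S).

Section AlgQuot.
Variables (K : fieldType) (A : algType K) (S : A -> Prop).
Variable S_proper : 1 \notin ideal S.
Local Notation Q := (alg_quot S_proper).

HB.instance Definition _ := GRing.Zmodule.on Q.
HB.instance Definition _ := EqQuotient.on Q.

Definition quot_pi (x : A) : Q := \pi_Q x.

Lemma quot_piP x y : reflect (quot_pi x = quot_pi y) (x - y \in ideal S).
Proof. by rewrite Quotient.idealrBE; apply: eqP. Qed.

Let qpiD : {morph quot_pi : x y / x + y}.
Proof. exact: (@Quotient.pi_add A (ideal S)). Qed.

Definition quot_one : Q := quot_pi 1.
Definition quot_mul (x y : Q) : Q := quot_pi (repr x * repr y).
Definition quot_scale (c : K) (x : Q) : Q := quot_pi (c *: repr x).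

Let repr_pi x : repr (quot_pi x) - x \in ideal S.
Proof. by apply/quot_piP; rewrite /quot_pi reprK. Qed.

Let qpiM x y : quot_mul (quot_pi x) (quot_pi y) = quot_pi (x * y).
Proof.
apply/quot_piP; set x' := repr _; set y' := repr _.
have -> : x' * y' - x * y = (x' - x) * y' + x * (y' - y).
  by rewrite mulrBl mulrBr addrA subrK.
by apply: ideal_add; [apply: ideal_mulr | apply: ideal_mull]; apply: repr_pi.
Qed.

Let qpiZ c x : quot_scale c (quot_pi x) = quot_pi (c *: x).
Proof.
by apply/quot_piP; rewrite -scalerBr -mulr_algl; apply/ideal_mull/repr_pi.
Qed.

Lemma quot_pi_surj (x : Q) : {y | x = quot_pi y}.
Proof. by exists (repr x); rewrite /quot_pi reprK. Qed.

Let quot_mulA : associative quot_mul.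
Proof.
move=> x y z; have [a ->] := quot_pi_surj x.
have [[b ->] [c ->]] := (quot_pi_surj y, quot_pi_surj z).
by rewrite !qpiM mulrA.
Qed.

Let quot_mul1l : left_id quot_one quot_mul.
Proof. by move=> x; have [a ->] := quot_pi_surj x; rewrite qpiM mul1r. Qed.

Let quot_mul1r : right_id quot_one quot_mul.
Proof. by move=> x; have [a ->] := quot_pi_surj x; rewrite qpiM mulr1. Qed.

Let quot_mulDl : left_distributive quot_mul +%R.
Proof.
move=> x y z; have [a ->] := quot_pi_surj x.
have [[b ->] [c ->]] := (quot_pi_surj y, quot_pi_surj z).
by rewrite -qpiD !qpiM mulrDl qpiD.
Qed.

Let quot_mulDr : right_distributive quot_mul +%R.
Proof.
move=> x y z; have [a ->] := quot_pi_surj x.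
have [[b ->] [c ->]] := (quot_pi_surj y, quot_pi_surj z).
by rewrite -qpiD !qpiM mulrDr qpiD.
Qed.

Let quot_one_neq0 : quot_one != 0.
Proof.
rewrite -(_ : quot_pi 0 = 0); last by apply: (addrI (quot_pi 0)); rewrite -qpiD !addr0.
by apply: contra S_proper => /eqP/quot_piP; rewrite subr0.
Qed.

HB.instance Definition _ := GRing.Zmodule_isNzRing.Build Q
  quot_mulA quot_mul1l quot_mul1r quot_mulDl quot_mulDr quot_one_neq0.

Let quot_scaleA a b x : quot_scale a (quot_scale b x) = quot_scale (a * b) x.
Proof. by have [y ->] := quot_pi_surj x; rewrite !qpiZ scalerA. Qed.

Let quot_scale1 : left_id 1 quot_scale.
Proof. by move=> x; have [y ->] := quot_pi_surj x; rewrite qpiZ scale1r. Qed.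

Let quot_scaleDr : right_distributive quot_scale +%R.
Proof.
move=> c x y; have [[a ->] [b ->]] := (quot_pi_surj x, quot_pi_surj y).
by rewrite -qpiD !qpiZ scalerDr qpiD.
Qed.

Let quot_scaleDl x : {morph quot_scale^~ x : a b / a + b}.
Proof.
by move=> a b /=; have [y ->] := quot_pi_surj x; rewrite !qpiZ scalerDl qpiD.
Qed.

HB.instance Definition _ := GRing.Zmodule_isLmodule.Build K Q
  quot_scaleA quot_scale1 quot_scaleDr quot_scaleDl.

Let quot_scaleAl (c : K) (x y : Q) : c *: (x * y) = c *: x * y.
Proof.
have [[a ->] [b ->]] := (quot_pi_surj x, quot_pi_surj y).
by rewrite /GRing.scale /GRing.mul /= !(qpiM, qpiZ) scalerAl.
Qed.

HB.instance Definition _ := GRing.Lmodule_isLalgebra.Build K Q quot_scaleAl.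

Let quot_scaleAr (c : K) (x y : Q) : c *: (x * y) = x * (c *: y).
Proof.
have [[a ->] [b ->]] := (quot_pi_surj x, quot_pi_surj y).
by rewrite /GRing.scale /GRing.mul /= !(qpiM, qpiZ) scalerAr.
Qed.

HB.instance Definition _ := GRing.Lalgebra_isAlgebra.Build K Q quot_scaleAr.

Let quot_pi_zmod_morphism : zmod_morphism quot_pi.
Proof.
move=> x y; apply: (addIr (quot_pi y)).
by rewrite subrK -qpiD subrK.
Qed.

Let quot_pi_monoid_morphism : monoid_morphism quot_pi.
Proof. by split=> // x y; rewrite -qpiM. Qed.

Let quot_pi_scalable : scalable quot_pi.
Proof. by move=> c x; rewrite -qpiZ. Qed.

HB.instance Definition _ := GRing.isZmodMorphism.Build A Q quot_pi
  quot_pi_zmod_morphism.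
HB.instance Definition _ := GRing.isMonoidMorphism.Build A Q quot_pi
  quot_pi_monoid_morphism.
HB.instance Definition _ := GRing.isScalable.Build K A Q *:%R quot_pi
  quot_pi_scalable.

End AlgQuot.

Definition free_algebra (K : fieldType) (X : choiceType) : Type :=
  {malg K[{fmonom X}]}.

Section FreeAlgebra.
Variables (K : fieldType) (X : choiceType).
Local Notation F := (free_algebra K X).

HB.instance Definition _ := GRing.Lalgebra.on F.

Let free_scaleAr (c : K) (x y : F) : c *: (x * y) = x * (c *: y).
Proof.
apply/malgP => m; rewrite mcoeffZ mcoeffMl.
rewrite (mcoeffMlw _ (fsubset_refl _) (msuppZ_le c y)) mulr_sumr.
apply: eq_bigr => k _; rewrite mulr_sumr; apply: eq_bigr => l _.
by rewrite mcoeffZ mulrCA mulrnAr.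
Qed.

HB.instance Definition _ := GRing.Lalgebra_isAlgebra.Build K F free_scaleAr.

Definition free_var (x : X) : F := << fmu x >>.

(* The augmentation, sending every generator to 0.                             *)
Definition free_aug : F -> K^o := @mcoeff {fmonom X} K (@mone _).

HB.instance Definition _ := GRing.RMorphism.on free_aug.
HB.instance Definition _ := GRing.isScalable.Build K F K^o *:%R free_aug
  (fun c x => mcoeffZ c x (@mone _)).

Lemma free_aug_var x : free_aug (free_var x) = 0.
Proof.
by rewrite /free_aug /free_var mcoeffU1 -(inj_eq val_inj) /= fmU fm1.
Qed.

End FreeAlgebra.

Section Presentation.
Variables (K : fieldType) (X : choiceType) (S : free_algebra K X -> Prop).
Hypothesis S_aug : forall r, S r -> free_aug r = 0.

Lemma presented_proper : 1 \notin ideal S.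
Proof.
apply/negP => /idealP; suff aug0 x : in_ideal S x -> free_aug x = 0.
  by move=> /aug0/eqP; rewrite rmorph1 oner_eq0.
elim=> [|a r b y /S_aug r0 _ y0]; first exact: rmorph0.
by rewrite rmorphD !rmorphM /= r0 y0 mulr0 mul0r addr0.
Qed.

Definition presented_algebra : algType K := alg_quot presented_proper.

Definition presented_gen (x : X) : presented_algebra :=
  quot_pi presented_proper (free_var K x).

End Presentation.

(* V = K^N with its standard basis.  Matrices of operators are written with   *)
(* the lower index as row and the upper index as column, so that l_i^j is the  *)
(* entry (i, j) of L and R_ij^kl is the entry ((i, j), (k, l)) of R.           *)
Section HeckeSymmetry.
Variables (K : fieldType) (N : nat).
Implicit Types (R Psi : 'M[K]_(N * N)) (q : K).

Definition tcoef R (i j k l : 'I_N) : K :=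
  R (mxtens_index (i, j)) (mxtens_index (k, l)).

Definition tens12 R : 'M[K]_(N * N * N) := R *t (1%:M : 'M_N).

(* The cast is harmless: mxtens_index sends (i, (j, k)) and ((i, j), k) to the *)
(* same natural number.                                                        *)
Definition tens23 R : 'M[K]_(N * N * N) :=
  castmx (mulnA N N N, mulnA N N N) ((1%:M : 'M_N) *t R).

Definition braid_relation R : Prop :=
  tens12 R *m tens23 R *m tens12 R = tens23 R *m tens12 R *m tens23 R.

Definition generic_parameter q : Prop :=
  q != 0 /\ forall n : int, n != 0 -> q ^ n != 1.

Definition hecke_symmetry q R : Prop :=
  [/\ generic_parameter q, braid_relation R
    & (q%:M - R) *m (q^-1%:M + R) = 0].

Definition skew_invertible R : Prop :=
  exists Psi, forall i k p q' : 'I_N,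
    \sum_(j < N) \sum_(l < N) tcoef R i j k l * tcoef Psi l p j q'
      = (i == q')%:R * (p == k)%:R.

End HeckeSymmetry.

(* Formal power series in u^-1 and v^-1 with matrix coefficients: F a b is the *)
(* coefficient of u^-a v^-b.                                                   *)
Section Series.
Variables (A : pzRingType) (n : nat).
Implicit Types (B : 'M[A]_n) (L : nat -> 'M[A]_n).

Definition series2 := nat -> nat -> 'M[A]_n.
Implicit Types F G : series2.

Definition series2_mul F G : series2 := fun a b =>
  \sum_(i < a.+1) \sum_(j < b.+1) F i j *m G (a - i)%N (b - j)%N.

Definition series2_const B : series2 := fun a b =>
  if (a == 0%N) && (b == 0%N) then B else 0.

Definition in_u L : series2 := fun a b => if b == 0%N then L a else 0.
Definition in_v L : series2 := fun a b => if a == 0%N then L b else 0.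

End Series.

Notation "F *s G" := (series2_mul F G) (at level 40, left associativity).

Section Relations.
Variables (K : fieldType) (A : algType K) (N : nat).
Implicit Types (R : 'M[K]_(N * N)) (q : K) (M : 'M[A]_N).
Implicit Types (L : nat -> 'M[A]_N).

Definition scal_mx R : 'M[A]_(N * N) := map_mx (in_alg A) R.

Definition leg1 M : 'M[A]_(N * N) := M *t (1%:M : 'M[A]_N).

Definition re_relator R M : 'M[A]_(N * N) :=
  scal_mx R *m leg1 M *m scal_mx R *m leg1 M
  - leg1 M *m scal_mx R *m leg1 M *m scal_mx R.

(* Since u / (u - v) = v^-1 / (v^-1 - u^-1), clearing the denominator of       *)
(* R(u, v) gives the polynomial                                                *)
(*   (v^-1 - u^-1) R(u, v) = (v^-1 - u^-1) R - v^-1 (q - q^-1) I.              *)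
(* The denominator is central and not a zero divisor, so both sides of the     *)
(* defining relation are multiplied by it before taking coefficients.          *)
Definition current_R q R : series2 A (N * N) := fun a b =>
  match a, b with
  | 0, 1 => scal_mx (R - (q - q^-1)%:M)
  | 1, 0 => - scal_mx R
  | _, _ => 0
  end.

Definition yangian_relator q R L : series2 A (N * N) := fun a b =>
  let Ruv := current_R q R in
  let R0 := series2_const (scal_mx R) in
  let L1u := in_u (fun k => leg1 (L k)) in
  let L1v := in_v (fun k => leg1 (L k)) in
  (Ruv *s L1u *s R0 *s L1v) a b - (L1v *s R0 *s L1u *s Ruv) a b.

End Relations.

Section Naturality.
Variables (K : fieldType) (A B : algType K) (f : {lrmorphism A -> B}) (N : nat).
Implicit Types (R : 'M[K]_(N * N)).

Lemma map_scal_mx R : map_mx f (scal_mx A R) = scal_mx B R.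
Proof. by apply/matrixP => i j; rewrite !mxE rmorph_alg. Qed.

Lemma map_leg1 (M : 'M[A]_N) : map_mx f (leg1 M) = leg1 (map_mx f M).
Proof. by rewrite /leg1 map_mxT map_mx1. Qed.

Lemma map_re_relator R (M : 'M[A]_N) :
  map_mx f (re_relator R M) = re_relator R (map_mx f M).
Proof. by rewrite map_mxB !map_mxM !map_scal_mx !map_leg1. Qed.

Let map_series2 n (F : series2 A n) : series2 B n :=
  fun a b => map_mx f (F a b).

Let map_series2_mul n (F G : series2 A n) :
  map_series2 (F *s G) = map_series2 F *s map_series2 G.
Proof.
apply/funext => a; apply/funext => b; rewrite /map_series2 /series2_mul.
rewrite raddf_sum; apply: eq_bigr => i _.
by rewrite raddf_sum; apply: eq_bigr => j _; rewrite /= map_mxM.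
Qed.

Lemma map_yangian_relator q R (L : nat -> 'M[A]_N) a b :
  map_mx f (yangian_relator q R L a b)
  = yangian_relator q R (fun k => map_mx f (L k)) a b.
Proof.
have mapR : map_series2 (current_R A q R) = current_R B q R.
  apply/funext => -[|[|c]]; apply/funext => -[|[|d]]; rewrite /map_series2 /=;
    by rewrite ?map_mxN ?map_scal_mx ?map_mx0.
have mapC : map_series2 (series2_const (scal_mx A R))
    = series2_const (scal_mx B R).
  apply/funext => c; apply/funext => d; rewrite /map_series2 /series2_const.
  by case: ifP; rewrite ?map_scal_mx ?map_mx0.
have mapU : map_series2 (in_u (fun k => leg1 (L k)))
    = in_u (fun k => leg1 (map_mx f (L k))).
  apply/funext => c; apply/funext => d; rewrite /map_series2 /in_u.
  by case: ifP; rewrite ?map_leg1 ?map_mx0.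
have mapV : map_series2 (in_v (fun k => leg1 (L k)))
    = in_v (fun k => leg1 (map_mx f (L k))).
  apply/funext => c; apply/funext => d; rewrite /map_series2 /in_v.
  by case: ifP; rewrite ?map_leg1 ?map_mx0.
rewrite /yangian_relator map_mxB.
by rewrite -mapR -mapC -mapU -mapV -!map_series2_mul.
Qed.

End Naturality.

Section TrivialSolutions.
Variables (K : fieldType) (A : algType K) (N : nat).
Implicit Types (R : 'M[K]_(N * N)).

Lemma re_relator0 R : re_relator R (0 : 'M[A]_N) = 0.
Proof. by rewrite /re_relator /leg1 tens0mx !(mulmx0, mul0mx) subr0. Qed.

Let mul_const n (F : series2 A n) (C : 'M[A]_n) :
  F *s series2_const C = fun a b => F a b *m C.
Proof.
apply/funext => a; apply/funext => b; rewrite /series2_mul.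
rewrite (bigD1 ord_max) //= (bigD1 ord_max) //= !subnn.
rewrite big1 => [|j jb].
  rewrite addr0 big1 ?addr0 // => i ia; apply: big1 => j _.
  rewrite /series2_const subn_eq0 leqNgt.
  by rewrite (_ : i < a)%N ?mulmx0 // ltn_neqAle ia -ltnS ltn_ord.
rewrite /series2_const [(b - j == 0)%N]subn_eq0 leqNgt.
by rewrite (_ : j < b)%N ?andbF ?mulmx0 // ltn_neqAle jb -ltnS ltn_ord.
Qed.

Let const_mul n (F : series2 A n) (C : 'M[A]_n) :
  series2_const C *s F = fun a b => C *m F a b.
Proof.
apply/funext => a; apply/funext => b; rewrite /series2_mul.
rewrite big_ord_recl big_ord_recl /= !subn0.
rewrite big1 => [|j _]; last by rewrite mul0mx.
by rewrite addr0 big1 ?addr0 // => i _; apply: big1 => j _; rewrite mul0mx.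
Qed.

Let mul_const1 n (F : series2 A n) : F *s series2_const 1%:M = F.
Proof.
by rewrite mul_const; apply/funext => a; apply/funext => b; rewrite mulmx1.
Qed.

Let const1_mul n (F : series2 A n) : series2_const 1%:M *s F = F.
Proof.
by rewrite const_mul; apply/funext => a; apply/funext => b; rewrite mul1mx.
Qed.

Lemma yangian_relator1 q R a b :
  yangian_relator q R (fun k => if k is 0 then 1%:M else 0 : 'M[A]_N) a b = 0.
Proof.
have leg1_1 : leg1 1%:M = 1%:M :> 'M[A]_(N * N).
  apply/matrixP => i j.
  case: (mxtens_indexP i) => i1 i2; case: (mxtens_indexP j) => j1 j2.
  rewrite tensmxE !mxE -natrM mulnb; congr (_%:R); congr nat_of_bool.
  by rewrite (can_eq (@mxtens_indexK N N)).
set L := fun k : nat => _.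
have inuE : in_u (fun k => leg1 (L k)) = series2_const 1%:M.
  apply/funext => -[|c]; apply/funext => -[|d] //=.
  by rewrite /in_u /= /leg1 tens0mx.
have invE : in_v (fun k => leg1 (L k)) = series2_const 1%:M.
  apply/funext => -[|c]; apply/funext => -[|d] //=.
  by rewrite /in_v /= /leg1 tens0mx.
rewrite /yangian_relator inuE invE !mul_const1 const1_mul mul_const const_mul.
apply/eqP; rewrite subr_eq0; apply/eqP.
case: a b => [|[|a]] [|[|b]] //=; rewrite ?(mulmx0, mul0mx) //.
  by rewrite -!map_mxM mulmxBl mulmxBr scalar_mxC.
by rewrite mulNmx mulmxN.
Qed.

End TrivialSolutions.

Section Algebras.
Variables (K : fieldType) (N : nat) (q : K) (R : 'M[K]_(N * N)).

Local Notation re_index := ('I_N * 'I_N)%type.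

Definition re_free_mx : 'M[free_algebra K re_index]_N :=
  \matrix_(i, j) free_var K (i, j).

Definition re_relation (r : free_algebra K re_index) : Prop :=
  exists i j, r = re_relator R re_free_mx i j.

Lemma re_relation_aug r : re_relation r -> free_aug r = 0.
Proof.
move=> [i [j ->]].
have /matrixP/(_ i j) := map_re_relator (@free_aug K re_index) R re_free_mx.
rewrite mxE => ->; rewrite (_ : map_mx _ _ = 0) ?re_relator0 ?mxE //.
by apply/matrixP => k l; rewrite !mxE; apply: free_aug_var.
Qed.

Definition re_algebra : algType K := presented_algebra re_relation_aug.

Definition re_mx : 'M[re_algebra]_N :=
  \matrix_(i, j) presented_gen re_relation_aug (i, j).

(* (i, j, k) indexes l_i^j[k + 1].                                             *)
Local Notation yangian_index := ('I_N * 'I_N * nat)%type.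

Definition yangian_free_mx (k : nat) : 'M[free_algebra K yangian_index]_N :=
  if k is k'.+1 then \matrix_(i, j) free_var K (i, j, k') else 1%:M.

Definition yangian_relation (r : free_algebra K yangian_index) : Prop :=
  exists a b i j, r = yangian_relator q R yangian_free_mx a b i j.

Lemma yangian_relation_aug r : yangian_relation r -> free_aug r = 0.
Proof.
move=> [a [b [i [j ->]]]].
have /matrixP/(_ i j) :=
  map_yangian_relator (@free_aug K yangian_index) q R yangian_free_mx a b.
rewrite mxE => ->; set L := fun k => _.
rewrite (_ : L = fun k => if k is 0 then 1%:M else 0).
  by rewrite yangian_relator1 mxE.
apply/funext => -[|k]; first by rewrite /L map_mx1.
by apply/matrixP => i' j'; rewrite !mxE; apply: free_aug_var.
Qed.

Definition braided_yangian : algType K :=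
  presented_algebra yangian_relation_aug.

Definition yangian_mx (k : nat) : 'M[braided_yangian]_N :=
  if k is k'.+1 then
    \matrix_(i, j) presented_gen yangian_relation_aug (i, j, k')
  else 1%:M.

End Algebras.

(* Main.v *)
(* Put x = u^-1, y = v^-1 and d = q - q^-1.  After clearing the denominator,   *)
(* the defining relation at L(u) = I + x M is the vanishing of                 *)
(*   ((y-x)R - yd) (I + x M1) R (I + y M1)                                     *)
(*     - (I + y M1) R (I + x M1) ((y-x)R - yd).                                *)
(* Its (y-x)R part is y(y-x)(R^2 M1 - M1 R^2) plus xy(y-x) times the           *)
(* reflection equation relator, and its yd part is -yd(y-x)(R M1 - M1 R).  The *)
(* Hecke relation R^2 = I + dR makes the two commutator terms cancel.          *)

From HB Require Import structures.
Require Import Defs.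
From mathcomp Require Import all_boot all_order all_algebra.
From mathcomp Require Import boolp reals.
From mathcomp.real_closed Require Import mxtens.
From mathcomp.multinomials Require Import monalg.

Set Implicit Arguments.
Unset Strict Implicit.
Unset Printing Implicit Defensive.

Import GRing.Theory.
Local Open Scope ring_scope.
Local Open Scope quotient_scope.

(** An algebra given by generators and relations maps to any algebra in which chosen images of the
    generators satisfy the relations ([presented_lift]). By naturality of the relators, what remains
    is to check the braided Yangian relation for $I + M/u$ inside the Reflection Equation algebra,
    where [re_relator_mx] supplies the equation for $M$. The Hecke relation says $R^{-1} = R - (q -
    q^{-1})I$ ([hecke_mul_sub]), so the cleared current matrix is $v^{-1}R^{-1} - u^{-1}R$, and
    [yangian_relator_eval] compares coefficients: each cancels trivially, by the Hecke relation, or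
    by the reflection equation. *)

Section FreeEval.
Variables (K : fieldType) (X : choiceType) (B : algType K) (h : X -> B).

Definition fmonom_eval (m : {fmonom X}) : B := \prod_(x <- (m : seq X)) h x.

Let fmonom_eval_mmorphism : mmorphism fmonom_eval.
Proof.
split=> [m1 m2|]; first by rewrite /fmonom_eval fmM big_cat.
by rewrite /fmonom_eval fm1 big_nil.
Qed.

HB.instance Definition _ :=
  isMultiplicative.Build {fmonom X} B fmonom_eval fmonom_eval_mmorphism.

Definition free_eval : free_algebra K X -> B := mmap (in_alg B) fmonom_eval.

HB.instance Definition _ := GRing.Additive.on free_eval.

Let free_eval_monoid_morphism : monoid_morphism free_eval.
Proof.
have [|evM ev1] := @commr_mmap_is_multiplicative {fmonom X} K B
    (in_alg B) fmonom_eval; last by split.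
(* Although [B] need not be commutative, scalar coefficients commute with every value of a monomial,
   which is enough for multiplicativity. *)
by move=> g m m'; rewrite /GRing.comm mulr_algl mulr_algr.
Qed.

Let free_eval_scalable : scalable free_eval.
Proof. by move=> c x; rewrite /free_eval mmapZ mulr_algl. Qed.

HB.instance Definition _ := GRing.isMonoidMorphism.Build _ _ free_eval
  free_eval_monoid_morphism.
HB.instance Definition _ := GRing.isScalable.Build K _ _ *:%R free_eval
  free_eval_scalable.

Lemma free_eval_var x : free_eval (free_var K x) = h x.
Proof.
rewrite /free_eval /free_var mmapU /= scale1r mul1r /fmonom_eval.
by rewrite (fmU x) big_seq1.
Qed.

End FreeEval.

Section QuotientLift.
Variables (K : fieldType) (A B : algType K) (S : A -> Prop).
Variables (S_proper : 1 \notin ideal S) (f : {lrmorphism A -> B}).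
Hypothesis fS : forall r, S r -> f r = 0.
Local Notation Q := (alg_quot S_proper).
Local Notation pi := (quot_pi S_proper).

(** The vanishing condition is an argument so that the morphism structures declared on the lift can
    rely on it. *)
Definition quot_lift of (forall r, S r -> f r = 0) : Q -> B :=
  fun x => f (repr x).
Local Notation lift := (quot_lift fS).

(** Two representatives of a class differ by an element of the ideal, and [f] kills the ideal by
    induction on its construction. *)
Lemma quot_lift_pi x : lift (pi x) = f x.
Proof.
apply/eqP; rewrite -subr_eq0 -rmorphB.
have /idealP : repr (pi x) - x \in ideal S.
  by apply/(quot_piP S_proper); rewrite /quot_pi reprK.
elim=> [|a r b y /fS r0 _ /eqP y0]; first by rewrite rmorph0.
by rewrite rmorphD !rmorphM /= r0 y0 mulr0 mul0r addr0.
Qed.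

Let lift_zmod_morphism : zmod_morphism lift.
Proof.
move=> x y; have [[a ->] [b ->]] := (quot_pi_surj x, quot_pi_surj y).
by rewrite -rmorphB !quot_lift_pi rmorphB.
Qed.

Let lift_monoid_morphism : monoid_morphism lift.
Proof.
split=> [|x y]; first by rewrite -(rmorph1 pi) quot_lift_pi rmorph1.
have [[a ->] [b ->]] := (quot_pi_surj x, quot_pi_surj y).
by rewrite -rmorphM !quot_lift_pi rmorphM.
Qed.

Let lift_scalable : scalable lift.
Proof.
move=> c x; have [a ->] := quot_pi_surj x.
by rewrite -linearZ !quot_lift_pi linearZ.
Qed.

HB.instance Definition _ := GRing.isZmodMorphism.Build Q B lift
  lift_zmod_morphism.
HB.instance Definition _ := GRing.isMonoidMorphism.Build Q B lift
  lift_monoid_morphism.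
HB.instance Definition _ := GRing.isScalable.Build K Q B *:%R lift
  lift_scalable.

End QuotientLift.

Lemma presented_lift (K : fieldType) (X : choiceType)
    (S : free_algebra K X -> Prop) (S_aug : forall r, S r -> free_aug r = 0)
    (B : algType K) (h : X -> B) :
  (forall r, S r -> free_eval h r = 0) ->
  exists phi : {lrmorphism presented_algebra S_aug -> B},
    forall x, phi (presented_gen S_aug x) = h x.
Proof.
move=> hS; exists (quot_lift (S_proper := presented_proper S_aug) hS) => x.
exact: etrans (quot_lift_pi (presented_proper S_aug) hS _) (free_eval_var h x).
Qed.

Lemma presented_rel (K : fieldType) (X : choiceType)
    (S : free_algebra K X -> Prop) (S_aug : forall r, S r -> free_aug r = 0) r :
  S r -> quot_pi (presented_proper S_aug) r = 0.
Proof.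
move=> Sr; rewrite -(rmorph0 (quot_pi (presented_proper S_aug))).
apply/quot_piP; rewrite subr0; apply/idealP.
rewrite -[r]addr0 -[r]mul1r -[1 * r]mulr1.
by constructor; last constructor.
Qed.

Lemma re_relator_mx (K : fieldType) (N : nat) (R : 'M[K]_(N * N)) :
  re_relator R (re_mx R) = 0.
Proof.
have -> : re_mx R
    = map_mx (quot_pi (presented_proper (@re_relation_aug K N R)))
        (re_free_mx K N).
  by apply/matrixP => i j; rewrite !mxE.
rewrite -map_re_relator; apply/matrixP => i j; rewrite mxE [RHS]mxE.
by apply: presented_rel; exists i, j.
Qed.

(** Expanding the Hecke relation gives $I + (q - q^{-1})R - R^2 = 0$. *)
Lemma hecke_mul_sub (K : fieldType) (n : nat) (q : K) (R : 'M[K]_n) :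
  q != 0 -> (q%:M - R) *m (q^-1%:M + R) = 0 -> R *m (R - (q - q^-1)%:M) = 1%:M.
Proof.
move=> q0; rewrite mulmxDr !mulmxBl -scalar_mxM divff //.
rewrite mul_mx_scalar mul_scalar_mx => e.
rewrite mulmxBr mul_mx_scalar scalerBl opprB.
apply/eqP; rewrite -subr_eq0 -oppr_eq0; apply/eqP; rewrite -[RHS]e.
rewrite opprB opprD opprB -addrA; congr (_ + _).
by rewrite [RHS]addrCA [LHS]addrC addrA.
Qed.

Section Evaluation.
Variables (K : fieldType) (A : algType K).

Lemma scal_mx_central n (c : K) (X : 'M[A]_(n * n)) :
  scal_mx A c%:M *m X = X *m scal_mx A c%:M.
Proof.
rewrite /scal_mx map_scalar_mx /= -diag_const_mx mul_diag_mx mul_mx_diag.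
by apply/matrixP => i j; rewrite !mxE mulr_algl mulr_algr.
Qed.

Lemma leg1_1 N : leg1 1%:M = 1%:M :> 'M[A]_(N * N).
Proof.
apply/matrixP => i j.
case: (mxtens_indexP i) => i1 i2; case: (mxtens_indexP j) => j1 j2.
rewrite tensmxE !mxE -natrM mulnb; congr (_%:R); congr nat_of_bool.
by rewrite (can_eq (@mxtens_indexK N N)).
Qed.

(** Products in the relator associate to the left, and at $I + M/u$ each right factor has total
    degree at most 1. This rule therefore computes every coefficient. *)
Lemma series2_mul_deg1 n (F G : series2 A n) a b :
  (forall i j, (1 < i + j)%N -> G i j = 0) ->
  (F *s G) a b = F a b *m G 0 0
    + (if a is a'.+1 then F a' b *m G 1 0 else 0)
    + (if b is b'.+1 then F a b' *m G 0 1 else 0).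
Proof.
move=> G0.
have -> : (F *s G) a b
    = \sum_(i < a.+1) \sum_(j < b.+1) F (a - i)%N (b - j)%N *m G i j.
  rewrite /series2_mul (reindex_inj rev_ord_inj); apply: eq_bigr => i _.
  rewrite (reindex_inj rev_ord_inj); apply: eq_bigr => j _ /=.
  by rewrite !subSS !subKn // -ltnS.
have inner i a' : \sum_(j < b.+1) F a' (b - j)%N *m G i j
    = F a' b *m G i 0 + (if b is b'.+1 then F a' b' *m G i 1 else 0).
  rewrite big_ord_recl subn0; congr (_ + _).
  case: b => [|b']; first by rewrite big_ord0.
  rewrite big_ord_recl subn1 big1 ?addr0 // => j _.
  by rewrite G0 ?mulmx0 // addnC.
under eq_bigr do rewrite inner.
rewrite big_ord_recl subn0 /= -!addrA; congr (_ + _); rewrite addrC.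
congr (_ + _); case: a => [|a]; first by rewrite big_ord0.
rewrite big_ord_recl /bump /= subn1 /= (G0 1 1)%N // big1.
  by rewrite addr0; case: (b) => [|b']; rewrite ?mulmx0 addr0.
by move=> i _; case: (b) => [|b']; rewrite !G0 // !mulmx0 addr0.
Qed.

(** Write x and y for $u^{-1}$ and $v^{-1}$, and r, m, s for $R$, $M_1$, $R^{-1}$. The relator
    becomes (ys - xr)(1 + xm)r(1 + ym) - (1 + ym)r(1 + xm)(ys - xr), of degree at most 2 in each
    variable. *)
Lemma yangian_relator_eval N (q : K) (R : 'M[K]_(N * N)) (M : 'M[A]_N) a b :
  R *m (R - (q - q^-1)%:M) = 1%:M -> re_relator R M = 0 ->
  yangian_relator q R
    (fun k => match k with 0 => 1%:M | 1 => M | _ => 0 end) a b = 0.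
Proof.
move=> RS /eqP; rewrite subr_eq0 => /eqP; set L := fun k : nat => _.
rewrite /yangian_relator; set r := scal_mx A R; set m := leg1 M => re.
have u_deg1 i j : (1 < i + j)%N -> in_u (fun k => leg1 (L k)) i j = 0.
  by case: i j => [|[|i]] [|j] //=; rewrite /in_u /= /leg1 tens0mx.
have v_deg1 i j : (1 < i + j)%N -> in_v (fun k => leg1 (L k)) i j = 0.
  by case: j i => [|[|j]] [|i] //=; rewrite /in_v /= /leg1 tens0mx.
have c_deg1 i j : (1 < i + j)%N -> series2_const r i j = 0.
  by case: i j => [|i] [|j].
have R_deg1 i j : (1 < i + j)%N -> current_R A q R i j = 0.
  by case: i j => [|[|i]] [|[|j]].
set U := in_u _ in u_deg1 *; set V := in_v _ in v_deg1 *.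
have mulC F i j : (F *s series2_const r) i j = F i j *m r.
  rewrite series2_mul_deg1 //.
  by case: i j => [|i] [|j]; rewrite !(mulmx0, addr0).
have mulU F i j : (F *s U) i j
    = F i j + (if i is i'.+1 then F i' j *m m else 0).
  rewrite series2_mul_deg1 // /U /in_u /= leg1_1 mulmx1.
  by case: i j => [|i] [|j]; rewrite !(mulmx0, addr0).
have mulV F i j : (F *s V) i j
    = F i j + (if j is j'.+1 then F i j' *m m else 0).
  rewrite series2_mul_deg1 // /V /in_v /= leg1_1 mulmx1.
  by case: i j => [|i] [|j]; rewrite !(mulmx0, addr0).
have mulR F i j : (F *s current_R A q R) i j
    = (if j is j'.+1 then F i j' *m scal_mx A (R - (q - q^-1)%:M) else 0)
      - (if i is i'.+1 then F i' j *m r else 0).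
  rewrite series2_mul_deg1 //= mulmx0 add0r addrC.
  by case: i j => [|i] [|j]; rewrite ?(mulmxN, mulmx0, addr0, subr0, oppr0).
set s := scal_mx A (R - (q - q^-1)%:M) in mulR *.
pose d := scal_mx A (q - q^-1)%:M : 'M[A]_(N * N).
have rs : r *m s = 1%:M by rewrite -map_mxM RS map_mx1.
have Er : r = d + s by rewrite -map_mxD addrC subrK.
have sr : s *m r = 1%:M by rewrite -rs {1 2}Er mulmxDl mulmxDr scal_mx_central.
have rr : r *m r = 1%:M + d *m r.
  by rewrite {2}Er mulmxDr rs scal_mx_central addrC.
(* This identity and the next bring the two sides of the xy coefficient to the common value m + rmr,
   since [d] is central and r = d + s. *)
have smr_mrr : s *m m *m r + m *m r *m r = m + r *m m *m r.
  rewrite -[m *m r *m r]mulmxA rr mulmxDr mulmx1 addrCA; congr (_ + _).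
  by rewrite {3}Er !mulmxDl addrC !mulmxA scal_mx_central.
have rrm_rms : r *m r *m m + r *m m *m s = m + r *m m *m r.
  rewrite rr mulmxDl mul1mx -addrA; congr (_ + _).
  by rewrite {4}Er mulmxDr -mulmxA scal_mx_central.
(* With s = r - d, this is the reflection equation minus the central multiple d mrm. *)
have smrm_mrms : s *m m *m r *m m = m *m r *m m *m s.
  rewrite -[s](addKr d) -Er !(mulmxDl, mulmxDr, mulNmx, mulmxN) re.
  by rewrite -!mulmxA scal_mx_central !mulmxA.
have leg10 : leg1 (0 : 'M[A]_N) = 0 by rewrite /leg1 tens0mx.
(* The x and $x^2$ coefficients cancel on simplification. The goals left are those of y, $y^2$, xy,
   $xy^2$ and $x^2y$, in this order. *)
case: a b => [|[|[|a]]] [|[|[|b]]];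
  rewrite !(mulC, mulU, mulV, mulR) /U /V /in_u /in_v /= -/s -/r -/m;
  rewrite ?(leg1_1, leg10, mul0mx, mulmx0, mul1mx, mulmx1, mulNmx, mulmxN);
  rewrite ?(addr0, add0r, subr0, oppr0, mul0mx, mulNmx, opprK, addNr) //.
- by rewrite sr rs subrr.
- by rewrite sr mul1mx -mulmxA rs mulmx1 subrr.
- by rewrite opprB addrACA -opprD smr_mrr rrm_rms subrr.
- by rewrite smrm_mrms subrr.
- by rewrite re addNr.
Qed.

End Evaluation.

Theorem proposition17 (F : realType) (g : ground_field) (N : nat)
    (q : scalars F g) (R : 'M[scalars F g]_(N * N))
    (R_hecke : hecke_symmetry q R) (R_skew : skew_invertible R) :
  exists phi : {lrmorphism braided_yangian q R -> re_algebra R},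
    map_mx phi (yangian_mx q R 1) = re_mx R /\
    forall k : nat, (2 <= k)%N -> map_mx phi (yangian_mx q R k) = 0.
Proof.
have [[q_neq0 _] _ /(hecke_mul_sub q_neq0) RS] := R_hecke.
(* The last index is shifted by one: 0 labels the entries of $L[1]$, which go to $M$, and all later
   levels go to 0. *)
pose h (x : 'I_N * 'I_N * nat) := if x.2 is 0 then re_mx R x.1.1 x.1.2 else 0.
have [|phi phiE] := presented_lift (@yangian_relation_aug _ N q R) (h := h).
  move=> _ [a [b [i [j ->]]]].
  have /matrixP/(_ i j) :=
    map_yangian_relator (free_eval h) q R (yangian_free_mx _ N) a b.
  rewrite mxE => ->; set L := fun k => _.
  rewrite (_ : L = fun k => match k with 0 => 1%:M | 1 => re_mx R | _ => 0 end).
    by rewrite (yangian_relator_eval _ _ RS (re_relator_mx R)) mxE.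
  apply/funext => -[|k]; first by rewrite /L map_mx1.
  apply/matrixP => i' j'; rewrite 2!mxE /= free_eval_var.
  by case: k => [|k] //; rewrite [RHS]mxE.
exists phi; split; first by apply/matrixP => i j; rewrite 2!mxE phiE.
by case=> [|[|k]] // _; apply/matrixP => i j; rewrite 2!mxE phiE mxE.
Qed.
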